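(* Fix any constant $c\ge 1$. There is a constant $\delta=\delta(c)$ such that the following holds. Let $\beta\in[0,1)$, $\gamma=1-\beta$, and $k\le n$ with $2\gamma k>2^{\delta}\log_2^2 n$. In the synchronous point-to-point Data Retrieval model with $k$ peers, an $n$-bit source, and a fixed Byzantine adversary corrupting at most $\beta k$ peers ($\beta$ known to the peers), there is a randomized algorithm for the Download problem such that, with probability at least $1-n^{-c}$, every nonfaulty peer outputs the source array correctly and $$\mathcal Q=O\!\left(\frac{n\log n}{\gamma k}\right),\qquad \mathcal T=O(n\log k),\qquad \mathcal M=O(nk^2).$$ Moreover, the algorithm only requires messages of size $O(1)$ bits. (The constants hidden in $O(\cdot)$ may depend on $c$ but not on $n,k,\beta$.)
   Context: Data Retrieval (DR) model. There are $k$ peers with unique IDs $1,\dots,k$ forming a complete network, and a trusted read-only external source storing an array $X=(b_1,\dots,b_n)\in\{0,1\}^n$, with $n\ge k$. A query $\mathrm{Query}(i)$ by a peer to the source returns $b_i$. Synchronous rounds: each round has three sub-rounds: (1) each peer sends any number (between $0$ and $n$) of queries to the source; (2) the source answers all of them; (3) peers exchange messages, which are delivered within the round. Point-to-point communication: a peer may send a different message to each other peer; the receiver knows the sender's ID. Local computation is free and instantaneous. Byzantine faults: a Byzantine (corrupted) peer deviates arbitrarily from the protocol, controlled by an adversary. At most $\beta k$ peers are ever corrupted; $\gamma=1-\beta$ is a lower bound on the fraction of nonfaulty peers. The adversary chooses $X$. Peers generate private local random bits. At the beginning of round $t$ the adversary knows $X$, all local random bits generated up to round $t-1$ and all communication (peer-peer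 and source-peer) up to round $t-1$, and may adaptively choose peers to corrupt at the start of each round. Fixed adversary: a corrupted peer remains corrupted for the rest of the execution. Download problem: every nonfaulty peer must output an array equal to $X$. Complexity measures: $\mathcal Q$ = maximum number of bits queried by any nonfaulty peer; $\mathcal T$ = number of rounds until termination; $\mathcal M$ = total number of messages sent by nonfaulty peers; message size = maximum number of bits in one message sent by a nonfaulty peer. *)

(* Defs.v *)
From HB Require Import structures.
From mathcomp Require Import all_boot all_order all_algebra.
From mathcomp Require Import reals exp.

Set Implicit Arguments.
Unset Strict Implicit.
Unset Printing Implicit Defensive.

Import Order.TTheory GRing.Theory Num.Theory.

Definition message := seq bool.

(* In each round every peer draws [coins] fresh private fair bits.  [None] is
   "no message" for [send], "not queried" for an answer, and "still running"
   for [output]: a peer terminates as soon as its output is [Some _]. *)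
Record protocol (n k : nat) := Protocol {
  state : Type;
  coins : nat;
  init : 'I_k -> state;
  output : 'I_k -> state -> option (n.-tuple bool);
  query : 'I_k -> state -> coins.-tuple bool -> {set 'I_n};
  send : 'I_k -> state -> coins.-tuple bool -> {ffun 'I_n -> option bool} ->
         'I_k -> option message;
  update : 'I_k -> state -> coins.-tuple bool -> {ffun 'I_n -> option bool} ->
           {ffun 'I_k -> option message} -> state
}.

(* Everything generated during one round; the source's answers are determined
   by the queries and the source array.  [messages l (i, j)] goes from i to j. *)
Record round_log (n k r : nat) := RoundLog {
  coin_flips : {ffun 'I_k -> r.-tuple bool};
  queries : {ffun 'I_k -> {set 'I_n}};
  messages : {ffun 'I_k * 'I_k -> option message}
}.

(* The adversary fixes the source array in advance.  At the start of a round it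
   sees the logs of all earlier rounds and its own [acoins] random bits; from
   these it chooses the peers to corrupt and the messages that corrupted peers
   send in this round.  Queries by corrupted peers are not modelled: they
   influence nobody else, and the adversary knows the array. *)
Record adversary (n k r : nat) := Adversary {
  source : n.-tuple bool;
  acoins : nat;
  corrupt : acoins.-tuple bool -> seq (round_log n k r) -> {set 'I_k};
  byz_send : acoins.-tuple bool -> seq (round_log n k r) ->
             'I_k -> 'I_k -> option message
}.

Record config (n k : nat) (P : protocol n k) := Config {
  states : 'I_k -> state P;
  faulty : {set 'I_k};
  history : seq (round_log n k (coins P))
}.

Section Execution.
Variables (n k : nat) (P : protocol n k) (A : adversary n k (coins P)).
Variable seed : (acoins A).-tuple bool.

Definition halted (c : config P) (i : 'I_k) : bool :=
  isSome (output i (states c i)).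

(* Corruption is permanent, and takes effect before the round's queries. *)
Definition step (c : config P) (w : {ffun 'I_k -> (coins P).-tuple bool}) :
    config P :=
  let F := faulty c :|: corrupt seed (history c) in
  let active i := (i \notin F) && ~~ halted c i in
  let Q := [ffun i => if active i then query i (states c i) (w i) else set0] in
  let ans i :=
    [ffun j => if j \in Q i then Some (tnth (source A) j) else None] in
  let M := [ffun p : 'I_k * 'I_k =>
    let: (i, j) := p in
    if i == j then None
    else if i \in F then byz_send seed (history c) i j
    else if active i then send i (states c i) (w i) (ans i) j
    else None] in
  let st i :=
    if active i then
      update i (states c i) (w i) (ans i) [ffun j => M (j, i)]
    else states c i in
  Config st F (rcons (history c) (RoundLog w Q M)).

Definition run (tape : seq {ffun 'I_k -> (coins P).-tuple bool}) : config P :=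
  foldl step (Config (@init n k P) set0 [::]) tape.

End Execution.

(* Randomness of an execution of H rounds: the peers' coins in each round, and
   the adversary's coins. *)
Definition outcome (n k : nat) (P : protocol n k) (A : adversary n k (coins P))
    (H : nat) : finType :=
  (H.-tuple {ffun 'I_k -> (coins P).-tuple bool} * (acoins A).-tuple bool)%type.

Section Measures.
Variables (n k : nat) (P : protocol n k) (A : adversary n k (coins P)).
Variables (H : nat) (w : outcome A H).

Definition config_at (t : nat) : config P := run w.2 (take t w.1).
Definition final : config P := config_at H.

(* A peer is nonfaulty if it is never corrupted during the execution. *)
Definition nonfaulty : {set 'I_k} := ~: faulty final.

Definition all_correct : bool :=
  [forall i in nonfaulty, output i (states final i) == Some (source A)].

Definition query_complexity : nat :=
  \max_(i in nonfaulty) \sum_(l <- history final) #|queries l i|.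

(* H.+1 if some nonfaulty peer is still running after round H. *)
Definition time_complexity : nat :=
  find (fun t => [forall i in nonfaulty, halted (config_at t) i]) (iota 0 H.+1).

Definition message_complexity : nat :=
  \sum_(l <- history final) \sum_(i in nonfaulty)
    #|[set j | isSome (messages l (i, j))]|.

Definition message_size : nat :=
  \max_(l <- history final) \max_(i in nonfaulty) \max_j
    size (odflt [::] (messages l (i, j))).

End Measures.

Local Open Scope ring_scope.

Definition corrupts_at_most (R : realType) (n k : nat) (P : protocol n k)
    (A : adversary n k (coins P)) (H : nat) (b : R) : Prop :=
  forall w : outcome A H, #|faulty (final w)|%:R <= b.

Definition uniform_prob (R : realType) (T : finType) (E : pred T) : R :=
  #|E|%:R / #|T|%:R.

Definition log2 (R : realType) (x : R) : R := ln x / ln 2.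

(* Main.v *)
Require Import Defs.
From mathcomp Require Import all_boot all_order all_algebra.
From mathcomp Require Import reals sequences exp.
From mathcomp Require Import zify ring lra.

(** The bits are learned one after the other, each in m + 1 stages.  In stage j
    a peer that does not know the bit yet queries it with probability
    2^(j - m), where 2^-m is about log n / (gamma k); a peer that knows the bit
    announces it once.  A peer that has not queried adopts a value as soon as at
    least 2^j peers, but fewer than 2^j for the opposite value, have announced
    it, where peers caught announcing a wrong value are ignored for ever.

    A Chernoff bound shows that in every stage at least 2^j nonfaulty peers draw
    the right to query and hence have announced the true value, so no wrong value
    is adopted and a peer reaches stage j + 1 only if 2^j new liars backed the
    wrong value.  Those are exposed as soon as the peer knows the bit, so the
    query probabilities of a peer add up to at most (n + 4 k) / 2^m, and an
    exponential supermartingale turns this into a bound on its actual queries. *)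

Set Implicit Arguments.
Unset Strict Implicit.
Unset Printing Implicit Defensive.

Import Order.TTheory GRing.Theory Num.Theory.

(** * The protocol: peer states, announcements and verdicts *)

Section Protocol.
Variables n k m : nat.

(* [heard s b u] is the value that u announced for bit b; the entry of the peer
   itself records that it has made its own announcement.  [exposure] has no
   influence on the run: it adds up 2 ^ m times the probabilities with which the
   peer was going to query. *)
Record peer := Peer {
  clock : nat;
  known : 'I_n -> option bool;
  heard : 'I_n -> 'I_k -> option bool;
  exposure : nat
}.

Implicit Types (s : peer) (r : m.-tuple bool).
Implicit Types ans : {ffun 'I_n -> option bool}.

Definition stage s := clock s %% m.+1.
Definition current s (b : 'I_n) := b == clock s %/ m.+1 :> nat.
Definition undecided s := [exists b, current s b && ~~ known s b].

(* An event of probability 2 ^ j / 2 ^ m, for j <= m. *)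
Definition lucky j r := (enum_rank r < 2 ^ j)%N.

Definition liars s : {set 'I_k} :=
  [set u | [exists b, known s b && (heard s b u == omap negb (known s b))]].

Definition supporters s b x : {set 'I_k} :=
  [set u | (u \notin liars s) && (heard s b u == Some x)].

Definition value s ans b := if known s b then known s b else ans b.

Definition vote (msg : option message) :=
  if msg is Some [:: x] then Some x else None.

Definition peer_query s r : {set 'I_n} :=
  [set b | [&& current s b, ~~ known s b & lucky (stage s) r]].

(** All recipients get the same message, and the peer's own entry of [heard] blocks a second
    announcement of a bit. *)
Definition peer_send (i : 'I_k) s ans : option message :=
  if [pick b | current s b && ~~ heard s b i] is Some b
  then omap (fun x => [:: x]) (value s ans b) else None.

(** Only the first announcement of the current bit counts, so a Byzantine peer cannot change the
    value it backs towards a given listener. *)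
Definition listen (i : 'I_k) s ans (msgs : {ffun 'I_k -> option message}) :=
  Peer (clock s) (known s)
    (fun b u => if current s b && ~~ heard s b u then
                  if u == i then value s ans b else vote (msgs u)
                else heard s b u)
    (exposure s).

Definition verdict s b :=
  [pick x | (2 ^ stage s <= #|supporters s b x|)
            && (#|supporters s b (~~ x)| < 2 ^ stage s)].

Definition decide s ans :=
  Peer (clock s).+1
    (fun b => if current s b then
                if value s ans b then value s ans b else verdict s b
              else known s b)
    (heard s)
    (exposure s + undecided s * 2 ^ stage s).

Definition download : protocol n k :=
  @Protocol n k peer m
    (fun=> Peer 0 (fun=> None) (fun _ _ => None) 0)
    (fun _ s => if n * m.+1 <= clock s
                then Some [tuple odflt false (known s b) | b < n] else None)
    (fun _ s r => peer_query s r)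
    (fun i s _ ans _ => peer_send i s ans)
    (fun i s _ ans msgs => decide (listen i s ans msgs) ans).

End Protocol.

(** * Supermartingales and generating functions over uniform coins *)

Section Probability.
Local Open Scope ring_scope.

Lemma sum_tuple_cons (R : numDomainType) (W : finType) (N : nat)
    (F : seq W -> R) :
  \sum_(t : N.+1.-tuple W) F t = \sum_w \sum_(t : N.-tuple W) F (w :: t).
Proof.
rewrite pair_big /=.
rewrite (reindex (fun p : W * N.-tuple W => [tuple of p.1 :: p.2])) //.
exists (fun t => (thead t, [tuple of behead t])) => [[w t] _|t _] /=.
  by rewrite theadE; congr (_, _); apply: val_inj.
by rewrite -tuple_eta.
Qed.

(** Sums replace expectations, hence the factors [#|W|]. The induction fixes the first symbol:
    [F (w :: _)] satisfies the same hypothesis with one step less. *)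
Lemma sum_supermartingale (R : numDomainType) (W : finType) (N : nat)
    (F : seq W -> R) :
  (forall s, (size s < N)%N -> \sum_w F (rcons s w) <= #|W|%:R * F s) ->
  \sum_(t : N.-tuple W) F t <= #|W|%:R ^+ N * F [::].
Proof.
elim: N F => [|N IHN] F hF.
  rewrite mul1r (bigD1 [tuple]) //= big1 ?addr0 // => t /eqP[].
  exact: tuple0.
rewrite sum_tuple_cons exprSr -mulrA.
apply: le_trans (_ : \sum_w #|W|%:R ^+ N * F [:: w] <= _); last first.
  by rewrite -mulr_sumr ler_wpM2l ?exprn_ge0 ?ler0n //; apply: (hF [::]).
apply: ler_sum => w _; apply: (IHN (fun s => F (w :: s))) => s lt.
exact: (hF (w :: s)).
Qed.

(** Unnormalised generating function of a Bernoulli variable: [enum_rank] makes exactly 2^j of the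
    2^m tuples lucky. *)
Lemma sum_lucky (R : numFieldType) (m j : nat) (y : R) : (j <= m)%N ->
  \sum_(r : m.-tuple bool) y ^+ lucky j r =
    2 ^+ m * (1 + (y - 1) * (2 ^+ j / 2 ^+ m)).
Proof.
move=> jm; have cardT : #|{: m.-tuple bool}| = (2 ^ m)%N.
  by rewrite card_tuple card_bool.
have card_lucky : #|[pred r : m.-tuple bool | lucky j r]| = (2 ^ j)%N.
  have le : (2 ^ j <= #|{: m.-tuple bool}|)%N by rewrite cardT leq_exp2l.
  have g_inj : injective (fun i : 'I_(2 ^ j) => enum_val (widen_ord le i)).
    by move=> i i' /enum_val_inj[] /val_inj.
  rewrite -[RHS]card_ord -(card_codom g_inj); apply: eq_card => r.
  apply/idP/codomP => [lr|[i ->]].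
    exists (Ordinal lr); rewrite -[LHS]enum_rankK; congr enum_val.
    exact: val_inj.
  by rewrite inE /lucky enum_valK /=.
rewrite (bigID (fun r => lucky j r)) /=.
rewrite (eq_bigr (fun=> y)) => [|r ->]; last by rewrite expr1.
rewrite [X in _ + X](eq_bigr (fun=> 1)) => [|r /negbTE->].
  2: by rewrite expr0.
rewrite !sumr_const card_lucky.
have -> : #|[pred r : m.-tuple bool | ~~ lucky j r]| = (2 ^ m - 2 ^ j)%N.
  rewrite -card_lucky -cardT -(cardC [pred r : m.-tuple bool | lucky j r]).
  by rewrite addKn; apply: eq_card.
rewrite -(mulr_natl y) natrB ?leq_exp2l // !natrX.
by field; rewrite expf_neq0 // pnatr_eq0.
Qed.

Lemma sum_flips_lucky (R : numFieldType) (I : finType) (m j : nat)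
    (B : {set I}) (y : R) : (j <= m)%N ->
  \sum_(w : {ffun I -> m.-tuple bool}) y ^+ #|[set i in B | lucky j (w i)]| =
    #|{ffun I -> m.-tuple bool}|%:R
      * (1 + (y - 1) * (2 ^+ j / 2 ^+ m)) ^+ #|B|.
Proof.
move=> jm.
pose f i (r : m.-tuple bool) := if i \in B then y ^+ lucky j r else 1.
transitivity (\sum_(w : {ffun I -> m.-tuple bool}) \prod_i f i (w i)).
  apply: eq_bigr => w _; rewrite /f -big_mkcond /= -expr_sum; congr (_ ^+ _).
  by rewrite -sum1_card big_mkcond [RHS]big_mkcond; apply: eq_bigr => i _;
     rewrite inE; case: (i \in B); case: (lucky _ _).
rewrite -(bigA_distr_bigA f) card_ffun card_tuple card_bool natrX natrX.
rewrite -prodr_const -[X in X * _]prodr_const [X in _ * X]big_mkcond.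
rewrite -big_split /=.
apply: eq_bigr => i _; rewrite /f; case: ifP => _; first exact: sum_lucky.
by rewrite sumr_const card_tuple card_bool -natrX mulr1.
Qed.
End Probability.

(** * Exponential tail estimates *)

Section ExponentialBounds.
Local Open Scope ring_scope.
Variable R : realType.
Implicit Types g p : R.

Lemma pow2_le_expR N : 2 ^+ N <= expR N%:R :> R.
Proof.
have two_e : 2 <= expR 1 :> R by rewrite (le_trans _ (expR_ge1Dx _)).
by rewrite -[N%:R]mulr1 expRM_natl lerXn2r ?nnegrE ?expR_ge0.
Qed.

Lemma pow_miss_le g p N : 0 <= p <= 1 -> g <= N%:R ->
  (1 + (1 / 2 - 1) * p) ^+ N <= expR (- (g * (p / 2))).
Proof.
move=> /andP[p0 p1] gN; apply: (@le_trans _ _ (expR (- (p / 2)) ^+ N)).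
  rewrite lerXn2r ?nnegrE ?expR_ge0 //; first by lra.
  by rewrite (le_trans _ (expR_ge1Dx _)) //; lra.
rewrite -expRM_natl ler_expR mulrN lerN2 ler_wpM2r //; lra.
Qed.

(** The left side is at most the exponential of 2^j (1 - g / 2^(m+1)). The bracket is nonpositive,
    so j = 0 is the worst case. *)
Lemma lower_tail_le g N m j : 2 ^+ m.+1 <= g -> g <= N%:R -> (j <= m)%N ->
  2 ^+ (2 ^ j) * (1 + (1 / 2 - 1) * (2 ^+ j / 2 ^+ m)) ^+ N <=
    expR (1 - g / 2 ^+ m.+1).
Proof.
move=> mg gN jm; have p2 i : 0 < 2 ^+ i :> R by rewrite exprn_gt0 // ltr0n.
have hp : 0 <= (2 ^+ j / 2 ^+ m : R) <= 1.
  rewrite divr_ge0 ?(ltW (p2 _)) //= ler_pdivrMr // mul1r.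
  by rewrite ler_eXn2l ?ltr1n.
have p0 : 0 <= 1 + (1 / 2 - 1) * (2 ^+ j / 2 ^+ m) :> R.
  by move: (_ / _ ^+ _) hp => p /andP[]; lra.
apply: le_trans (ler_pM _ _ (pow2_le_expR _) (pow_miss_le hp gN)) _;
  rewrite ?exprn_ge0 //.
rewrite -expRD ler_expR natrX.
have -> : 2 ^+ j - g * (2 ^+ j / 2 ^+ m / 2) = 2 ^+ j * (1 - g / 2 ^+ m.+1).
  by rewrite [2 ^+ m.+1]exprS; field; rewrite gt_eqF.
rewrite -[leRHS]mul1r ler_wnM2r //; last by rewrite exprn_ege1 // ler1n.
by rewrite subr_le0 ler_pdivlMr // mul1r.
Qed.

End ExponentialBounds.

(** * Executions: logs, clocks and queries of one round *)

Section Execution.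
Variables (n k m : nat).
Notation P := (download n k m).
Variables (A : adversary n k (coins P)) (seed : (acoins A).-tuple bool).
Notation flips := {ffun 'I_k -> (coins P).-tuple bool}.
Implicit Types (s : seq flips) (w : flips) (c : config P).
Notation exec := (run seed).
Notation peer_at s i := (states (exec s) i : peer n k).

Lemma run_rcons s w : exec (rcons s w) = step seed (exec s) w.
Proof. exact: foldl_rcons. Qed.

Lemma halted_clock c i :
  halted c i = (n * m.+1 <= clock (states c i : peer n k)).
Proof. by rewrite /halted /=; case: ifP. Qed.

Lemma faulty_rcons s w : faulty (exec s) \subset faulty (exec (rcons s w)).
Proof. by rewrite run_rcons subsetUl. Qed.

Lemma faulty_take s t : faulty (exec (take t s)) \subset faulty (exec s).
Proof.
rewrite -{2}(cat_take_drop t s); elim/last_ind: (drop t s) => [|u w IHu].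
  by rewrite cats0.
by rewrite -rcons_cat; apply: subset_trans IHu (faulty_rcons _ _).
Qed.

Lemma honest_prev s w i :
  i \notin faulty (exec (rcons s w)) -> i \notin faulty (exec s).
Proof. by apply: contraNN => /(subsetP (faulty_rcons s w)). Qed.

Definition last_round s w : round_log n k (coins P) :=
  last (RoundLog w [ffun=> set0] [ffun=> None]) (history (exec (rcons s w))).

Definition answers s w i : {ffun 'I_n -> option bool} :=
  [ffun b => if b \in queries (last_round s w) i
             then Some (tnth (source A) b) else None].

Definition inbox s w i : {ffun 'I_k -> option message} :=
  [ffun u => messages (last_round s w) (u, i)].

Lemma history_rcons s w :
  history (exec (rcons s w)) = rcons (history (exec s)) (last_round s w).
Proof. by rewrite /last_round run_rcons /= last_rcons. Qed.

Definition running s w i :=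
  (i \notin faulty (exec (rcons s w))) && (clock (peer_at s i) < n * m.+1).

Lemma queries_last s w i :
  queries (last_round s w) i =
    if running s w i then peer_query (peer_at s i) (w i) else set0.
Proof.
rewrite /running /last_round run_rcons /= last_rcons /= ffunE.
by rewrite halted_clock -ltnNge.
Qed.

Lemma running_step s w i : running s w i ->
  peer_at (rcons s w) i =
  decide m (listen m i (peer_at s i) (answers s w i) (inbox s w i))
    (answers s w i).
Proof.
rewrite /running /answers /inbox /last_round run_rcons /= last_rcons /=.
by move=> Hr; rewrite halted_clock -ltnNge Hr.
Qed.

Lemma stopped_step s w i : ~~ running s w i ->
  peer_at (rcons s w) i = peer_at s i.
Proof.
rewrite /running run_rcons /= halted_clock -ltnNge => Hr.
by rewrite (negbTE Hr).
Qed.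

Lemma messages_last s w i j : i \notin faulty (exec (rcons s w)) -> i != j ->
  messages (last_round s w) (i, j) =
    if running s w i then peer_send m i (peer_at s i) (answers s w i)
    else None.
Proof.
rewrite /answers /running /last_round run_rcons /= last_rcons /=.
move=> iF ij; rewrite ffunE /= (negbTE ij) (negbTE iF) /=.
by rewrite halted_clock -ltnNge.
Qed.

Lemma messages_self s w i : messages (last_round s w) (i, i) = None.
Proof.
by rewrite /last_round run_rcons /= last_rcons /= ffunE /= eqxx.
Qed.

(** Nonfaulty peers advance in lockstep until they halt, so the current bit and the stage depend on
    the round number alone. *)
Lemma clock_at s i : i \notin faulty (exec s) ->
  clock (peer_at s i) = minn (size s) (n * m.+1).
Proof.
elim/last_ind: s => [|s w IHs] iF; first by rewrite min0n.
have [Hr|Hr] := boolP (running s w i).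
  rewrite running_step //= size_rcons; case/andP: Hr => _.
  rewrite (IHs (honest_prev iF)); move: (size s) (n * m.+1) => a T lt; lia.
rewrite stopped_step // size_rcons; move: Hr; rewrite /running iF /=.
by rewrite (IHs (honest_prev iF)); move: (size s) (n * m.+1) => a T lt; lia.
Qed.

Lemma current_inj (p : peer n k) b b' :
  current m p b -> current m p b' -> b = b'.
Proof. by move=> /eqP cb /eqP cb'; apply: val_inj; rewrite /= cb. Qed.

Lemma card_queries_last s w i :
  #|queries (last_round s w) i| =
  running s w i && undecided m (peer_at s i) &&
    lucky (stage m (peer_at s i)) (w i).
Proof.
rewrite queries_last; case: (running _ _ _) => /=; last by rewrite cards0.
have [/existsP[b /andP[cb kb]]|/existsPn Hu] := boolP (undecided _ _) => /=.
  case Hl: (lucky _ _) => /=.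
    rewrite -(cards1 b); apply: eq_card => b'; rewrite !inE.
    apply/idP/eqP => [/and3P[cb' _ _]|->]; first exact: current_inj cb' cb.
    by apply/and3P.
  by apply: eq_card0 => b'; rewrite !inE Hl !andbF.
by apply: eq_card0 => b'; rewrite !inE andbA (negbTE (Hu b')).
Qed.

Lemma exposure_rcons s w i :
  exposure (peer_at (rcons s w) i) = exposure (peer_at s i) +
    (running s w i && undecided m (peer_at s i))
      * 2 ^ stage m (peer_at s i).
Proof.
have [Hr|Hr] := boolP (running s w i); first by rewrite running_step.
by rewrite stopped_step //= addn0.
Qed.

(** * Size and number of messages *)

Lemma size_peer_send i (p : peer n k) ans :
  size (odflt [::] (peer_send m i p ans)) <= 1.
Proof. by rewrite /peer_send; case: pickP => // b _; case: value. Qed.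

Lemma message_size_le1 s (D : {set 'I_k}) : [disjoint D & faulty (exec s)] ->
  \max_(l <- history (exec s)) \max_(i in D) \max_j
    size (odflt [::] (messages l (i, j))) <= 1.
Proof.
elim/last_ind: s => [|s w IHs] dis; first by rewrite big_nil.
rewrite history_rcons -cats1 big_cat big_seq1 /= geq_max.
rewrite IHs ?(disjointWr (faulty_rcons s w)) //=.
apply/bigmax_leqP => i iD; apply/bigmax_leqP => j _.
have [<-|ij] := eqVneq i j; first by rewrite messages_self.
have iF : i \notin faulty (exec (rcons s w)).
  by rewrite (disjointFr dis).
by rewrite messages_last //; case: ifP => // _; apply: size_peer_send.
Qed.

(** A round in which [i] sends also fills its own, previously empty, entry for the current bit; that
    entry pays for the at most k messages of the round. *)
Lemma message_count s i : i \notin faulty (exec s) ->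
  \sum_(l <- history (exec s)) #|[set j | messages l (i, j)]|
    <= k * #|[set b | heard (peer_at s i) b i]|.
Proof.
elim/last_ind: s => [|s w IHs] iF; first by rewrite big_nil.
have {}IHs := IHs (honest_prev iF).
rewrite history_rcons -cats1 big_cat big_seq1 /=.
set sent := [set j | _].
have [Hr|Hr] := boolP (running s w i); last first.
  rewrite stopped_step // (_ : sent = set0) ?cards0 ?addn0 //.
  apply/setP => j; rewrite !inE; have [<-|ij] := eqVneq i j.
    by rewrite messages_self.
  by rewrite messages_last // (negbTE Hr).
rewrite running_step //=.
set old := [set b | _] in IHs *; set new := [set b | _].
have old_new : old \subset new.
  by apply/subsetP => b; rewrite !inE => hb; rewrite hb andbF.
have [sent0|[j]] := set_0Vmem sent.
  rewrite sent0 cards0 addn0; apply: leq_trans IHs _.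
  by rewrite leq_mul2l subset_leq_card ?orbT.
rewrite inE; have [<-|ij] := eqVneq i j; first by rewrite messages_self.
rewrite messages_last // Hr /peer_send; case: pickP => // b /andP[cb hb].
case Ev: value => [x|] // _.
have : old \proper new.
  rewrite properE old_new; apply/subsetPn; exists b; rewrite !inE ?cb ?hb //=.
  by rewrite eqxx Ev.
move=> /proper_card lt; apply: leq_trans (leq_mul (leqnn k) lt).
rewrite mulnS addnC leq_add // -[leqRHS]card_ord; exact: max_card.
Qed.

Lemma message_total_le s (D : {set 'I_k}) : [disjoint D & faulty (exec s)] ->
  \sum_(l <- history (exec s)) \sum_(i in D) #|[set j | messages l (i, j)]|
    <= n * k ^ 2.
Proof.
move=> dis; rewrite exchange_big /=.
apply: (@leq_trans (\sum_(i in D) k * n)).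
  apply: leq_sum => i iD; apply: leq_trans (message_count _) _.
    by rewrite (disjointFr dis).
  by rewrite leq_mul2l -[leqRHS]card_ord max_card orbT.
rewrite sum_nat_const mulnA mulnC expnS expn1 leq_mul2l leq_mul2r.
by rewrite -[leqRHS]card_ord max_card !orbT.
Qed.

(** * Lucky rounds and the invariant *)

Definition unlucky s w :=
  #|[set i | (i \notin faulty (exec (rcons s w)))
             && lucky (size s %% m.+1) (w i)]| < 2 ^ (size s %% m.+1).

Lemma lucky_last_stage (r : m.-tuple bool) : lucky m r.
Proof.
by rewrite /lucky (leq_trans (ltn_ord _)) // card_tuple card_bool.
Qed.

Lemma neq_negb (x y : bool) : x != y -> y = ~~ x.
Proof. by case: x; case: y. Qed.

Lemma dvdn_succ d t : (d.+1 %| t.+1) = (t %% d.+1 == d).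
Proof.
rewrite {1}(divn_eq t d.+1) -addnS dvdn_addr ?dvdn_mull //.
have lt := ltn_pmod t (ltn0Sn d); apply/idP/eqP => [dv|->]; last exact: dvdnn.
by apply/eqP; rewrite eqn_leq -ltnS lt /= -ltnS dvdn_leq.
Qed.

(** The last three fields do the accounting. At stage j an unknown bit has cost 1 + ... + 2^(j-1) <
    2^j, and for j > 0 the failed verdict of the previous stage left 2^(j-1) unexposed backers of
    the wrong value. Learning the bit at stage j > 0 keeps its cost below 2^(j+1), which is 4 times
    this number of new liars. A bit learned at stage 0 costs 1; the term [0 < size s %% m.+1] is
    this allowance for the current bit. *)
Record sound s : Prop := Sound {
  known_true i b x : i \notin faulty (exec s) ->
    known (peer_at s i) b = Some x -> x = tnth (source A) b;
  known_past i (b : 'I_n) : i \notin faulty (exec s) ->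
    b < size s %/ m.+1 -> known (peer_at s i) b;
  heard_true i u b x : i \notin faulty (exec s) -> u \notin faulty (exec s) ->
    heard (peer_at s i) b u = Some x -> x = tnth (source A) b;
  heard_own i u b : i \notin faulty (exec s) -> u \notin faulty (exec s) ->
    heard (peer_at s u) b u -> heard (peer_at s i) b u;
  exposure_decided i : i \notin faulty (exec s) ->
    ~~ undecided m (peer_at s i) ->
    exposure (peer_at s i) <= size s %/ m.+1 + (0 < size s %% m.+1)
                              + 4 * #|liars (peer_at s i)|;
  exposure_undecided i b : i \notin faulty (exec s) ->
    current m (peer_at s i) b -> ~~ known (peer_at s i) b ->
    exposure (peer_at s i) < size s %/ m.+1 + 2 ^ (size s %% m.+1)
                             + 4 * #|liars (peer_at s i)|;
  conflict i b : i \notin faulty (exec s) ->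
    current m (peer_at s i) b -> ~~ known (peer_at s i) b ->
    0 < size s %% m.+1 -> 2 ^ (size s %% m.+1).-1 <=
      #|supporters (peer_at s i) b (~~ tnth (source A) b)|
}.

Lemma sound_nil : sound [::].
Proof.
split=> //= i *; rewrite ?div0n // addnC.
Qed.

(** * A lucky round preserves the invariant *)

Section Step.
Variables (s : seq flips) (w : flips).
Hypotheses (Hs : sound s) (size_s : size s < n * m.+1).
Hypothesis Hw : ~~ unlucky s w.

Notation j := (size s %% m.+1).
Notation F' := (faulty (exec (rcons s w))).
Notation X b := (tnth (source A) b).
Notation old i := (peer_at s i).
Notation mid i :=
  (listen m i (peer_at s i) (answers s w i) (inbox s w i)).
Notation new i := (peer_at (rcons s w) i).
Notation val_ i b := (value (peer_at s i) (answers s w i) b).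

Lemma clock_old i : i \notin F' -> clock (old i) = size s.
Proof.
by move=> iF; rewrite (clock_at (honest_prev iF)); apply/minn_idPl/ltnW.
Qed.

Lemma honest_running i : i \notin F' -> running s w i.
Proof. by move=> iF; rewrite /running iF clock_old. Qed.

Lemma new_decide i : i \notin F' ->
  new i = decide m (mid i) (answers s w i).
Proof. by move/honest_running/running_step. Qed.

Lemma value_true i b x : i \notin F' -> val_ i b = Some x -> x = X b.
Proof.
move=> iF; rewrite /value; case Ek: known => [y|].
  by case=> <-; apply: (known_true Hs (honest_prev iF) Ek).
by rewrite ffunE; case: ifP => // _ [].
Qed.

(** Announcements arrive in the round in which they are sent, and by [heard_own] an empty entry at
    [i] means that [u] has not announced yet. *)
Lemma heard_mid i u b : i \notin F' -> u \notin F' ->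
  heard (mid i) b u =
    if heard (old i) b u then heard (old i) b u else
    if current m (old i) b then val_ u b else None.
Proof.
move=> iF uF /=; case Eh: (heard (old i) b u) => [x|]; rewrite ?andbF //=.
case cb: (current _ _ _) => //=; case: (eqVneq u i) => [->//|ui].
have hu : ~~ heard (old u) b u.
  apply/negP=> hu; have := heard_own Hs (honest_prev iF) (honest_prev uF) hu.
  by rewrite Eh.
have cu : current m (old u) b by move: cb; rewrite /current !clock_old.
rewrite ffunE messages_last // honest_running // /peer_send.
case: pickP => [b' /andP[cb' _]|/(_ b)]; last by rewrite cu hu.
by rewrite (current_inj cu cb'); case: value.
Qed.

Lemma heard_mid_true i u b x : i \notin F' -> u \notin F' ->
  heard (mid i) b u = Some x -> x = X b.
Proof.
move=> iF uF; rewrite heard_mid //; case Eh: (heard (old i) b u) => [y|].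
  by case=> <-; apply: (heard_true Hs (honest_prev iF) (honest_prev uF) Eh).
by case: ifP => // _; apply: value_true.
Qed.

(** A lucky peer has announced the bit before, or knows it, or queries it now; in the last two cases
    it announces at once. *)
Lemma lucky_heard i u b : i \notin F' -> u \notin F' -> lucky j (w u) ->
  current m (old i) b -> heard (mid i) b u = Some (X b).
Proof.
move=> iF uF lu cb; have cu : current m (old u) b.
  by move: cb; rewrite /current !clock_old.
suff: isSome (heard (mid i) b u).
  by case Eh: heard => [x|] // _; rewrite (heard_mid_true iF uF Eh).
rewrite heard_mid // cb; case: (heard _ _ _) => //=.
rewrite /value; case: ifP => // ku.
rewrite ffunE queries_last honest_running //.
by rewrite inE cu ku /= /stage clock_old // lu.
Qed.

Lemma honest_liars i u : i \notin F' -> u \notin F' -> u \notin liars (mid i).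
Proof.
move=> iF uF; rewrite inE; apply/existsP => -[b /andP[/= kb /eqP]].
move: kb; case Ek: known => [x|] //= _ hb.
have := heard_mid_true iF uF hb.
by rewrite (known_true Hs (honest_prev iF) Ek); case: (tnth _ _).
Qed.

Lemma true_supporters i b : i \notin F' -> current m (old i) b ->
  2 ^ j <= #|supporters (mid i) b (X b)|.
Proof.
move=> iF cb; move: Hw; rewrite /unlucky -leqNgt => /leq_trans-> //.
apply/subset_leq_card/subsetP => u; rewrite inE => /andP[uF lu].
by rewrite inE honest_liars // (lucky_heard iF uF lu cb) eqxx.
Qed.

Lemma stage_mid i : i \notin F' -> stage m (mid i) = j.
Proof. by move=> iF; rewrite /stage /= clock_old. Qed.

Lemma verdict_true i b x : i \notin F' -> current m (old i) b ->
  verdict m (mid i) b = Some x -> x = X b.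
Proof.
move=> iF cb; rewrite /verdict stage_mid //; case: pickP => // y.
case/andP=> _ lt [<-]; have := true_supporters iF cb.
have [->//|neq] := eqVneq y (X b).
by rewrite (neq_negb neq) leqNgt lt.
Qed.

Lemma verdict_None i b : i \notin F' -> current m (old i) b ->
  verdict m (mid i) b = None -> 2 ^ j <= #|supporters (mid i) b (~~ X b)|.
Proof.
move=> iF cb; rewrite /verdict stage_mid //; case: pickP => // /(_ (X b)).
by rewrite true_supporters //= => /negbT; rewrite -leqNgt.
Qed.

Lemma known_new i b : i \notin F' -> known (new i) b =
  if current m (old i) b then
    if val_ i b then val_ i b else verdict m (mid i) b
  else known (old i) b.
Proof. by move=> iF; rewrite new_decide. Qed.

Lemma known_keep i b : i \notin F' -> known (old i) b ->
  known (new i) b = known (old i) b.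
Proof.
by move=> iF kb; rewrite known_new // /value kb; case: ifP => // _; rewrite kb.
Qed.

Lemma heard_keep i b u : i \notin F' -> heard (old i) b u ->
  heard (new i) b u = heard (old i) b u.
Proof. by move=> iF hb; rewrite new_decide //= hb andbF. Qed.

Lemma liars_new i : i \notin F' -> liars (old i) \subset liars (new i).
Proof.
move=> iF; apply/subsetP => u; rewrite !inE.
case/existsP => b /andP[kb hb]; apply/existsP; exists b.
rewrite known_keep // kb /= heard_keep //.
by rewrite (eqP hb); case: known kb.
Qed.

(** In a lucky round a learned value is true, so the backers of the opposite one become liars.
    Supporters exclude earlier liars, hence the two counts add up. *)
Lemma conflict_liars i b : i \notin F' -> ~~ known (old i) b ->
  known (new i) b ->
  #|liars (old i)| + #|supporters (old i) b (~~ X b)| <= #|liars (new i)|.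
Proof.
move=> iF kb kb'.
have known_X : known (new i) b = Some (X b).
  move: kb'; rewrite known_new //.
  case: ifP => [cb|_]; last by rewrite (negbTE kb).
  case Ev: value => [x|] /=; first by rewrite (value_true iF Ev).
  by case Ed: verdict => [x|] // _; rewrite (verdict_true iF cb Ed).
have dis : [disjoint liars (old i) & supporters (old i) b (~~ X b)].
  rewrite disjoint_sym disjoints_subset; apply/subsetP => u.
  by rewrite !inE => /andP[].
rewrite -[leqLHS]subn0 -(cards0 'I_k) -(disjoint_setI0 dis) -cardsU.
apply/subset_leq_card; rewrite subUset liars_new //=.
apply/subsetP => u; rewrite inE => /andP[_ hu].
rewrite inE; apply/existsP; exists b.
by rewrite known_X heard_keep // (eqP hu) /=.
Qed.

Lemma known_last_stage i b : i \notin F' -> current m (old i) b ->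
  j = m -> known (new i) b.
Proof.
move=> iF cb jm; have := known_new b iF; rewrite cb => ->.
suff: val_ i b by case: value.
rewrite /value; case: ifP => // kb.
rewrite ffunE queries_last honest_running //.
by rewrite inE cb kb /= /stage clock_old // jm lucky_last_stage.
Qed.

Lemma exposure_new i b : i \notin F' -> current m (old i) b ->
  exposure (new i) = exposure (old i) + ~~ known (old i) b * 2 ^ j.
Proof.
move=> iF cb; rewrite exposure_rcons honest_running //= /stage clock_old //.
congr (_ + nat_of_bool _ * _); apply/existsP/idP => [[b' /andP[cb' kb']]|kb].
  by rewrite (current_inj cb cb').
by exists b; rewrite cb.
Qed.

Lemma exposure_new_known i b : i \notin F' -> current m (old i) b ->
  known (new i) b ->
  exposure (new i) <= (size s %/ m.+1).+1 + 4 * #|liars (new i)|.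
Proof.
move=> iF cb kb'; rewrite (exposure_new iF cb).
have iF0 := honest_prev iF; have ll := subset_leq_card (liars_new iF).
have [kb|kb] := boolP (isSome (known (old i) b));
  rewrite /= ?mul0n ?addn0 ?mul1n.
  apply: leq_trans (exposure_decided Hs iF0 _) _.
    apply/existsPn => b'; have [cb'|//] := boolP (current _ _ _).
    by rewrite -(current_inj cb cb') kb.
  move: (leq_b1 (0 < j)) ll.
  by move: (_ %/ _) #|_| #|_| (nat_of_bool _) => q L L' d *; lia.
(* For j = 0 the new cost 1 is the allowance of this bit. For j = r + 1 the cost stays below 2^(j+1)
   = 4 2^r, which at least 2^r new liars pay for. *)
move: (conflict_liars iF kb kb') (conflict Hs iF0 cb kb).
move: (exposure_undecided Hs iF0 cb kb).
move: (_ %/ _) (exposure _) #|liars _| #|liars _| #|supporters _ _ _| j.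
move=> q e L L' S [|r] /=; first by rewrite expn0 => *; lia.
by rewrite expnS => ? ? /(_ isT); lia.
Qed.

Lemma exposure_new_unknown i b : i \notin F' -> current m (old i) b ->
  ~~ known (new i) b ->
  exposure (new i) < size s %/ m.+1 + 2 ^ j.+1 + 4 * #|liars (new i)|.
Proof.
move=> iF cb kb'; rewrite (exposure_new iF cb).
have kb : ~~ known (old i) b by apply: contraNN kb' => kb; rewrite known_keep.
move: (exposure_undecided Hs (honest_prev iF) cb kb).
move: (subset_leq_card (liars_new iF)); rewrite kb mul1n expnS.
by move: (_ %/ _) (exposure _) (2 ^ _) #|_| #|_| => q e p L L' *; lia.
Qed.

Lemma conflict_new i b : i \notin F' -> current m (old i) b ->
  ~~ known (new i) b -> 2 ^ j <= #|supporters (new i) b (~~ X b)|.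
Proof.
move=> iF cb kb'.
(* Nothing is learned in this round, so the verdict exposes no further liars and the supporters that
   it counted persist. *)
have kE b' : known (new i) b' = known (old i) b'.
  have [kb|kb] := boolP (isSome (known (old i) b')).
    exact: known_keep.
  have [cb'|cb'] := boolP (current m (old i) b').
    rewrite -(current_inj cb cb') in kb *.
    by case: (known (new i) b) kb' => //; case: (known (old i) b) kb.
  by rewrite known_new // (negbTE cb').
have -> : supporters (new i) b (~~ X b) = supporters (mid i) b (~~ X b).
  have lE : liars (new i) = liars (mid i).
    apply/setP => u; rewrite !inE; apply: eq_existsb => b'.
    by rewrite kE new_decide.
  by rewrite /supporters lE new_decide.
apply: verdict_None => //; move: kb'; rewrite known_new // cb.
by case: (val_ i b) => [x|] //=; case: verdict.
Qed.

Lemma sound_rcons : sound (rcons s w).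
Proof.
have hp := @honest_prev s w.
have new_heard i b u : i \notin F' -> heard (new i) b u = heard (mid i) b u.
  by move=> iF; rewrite new_decide.
have new_clock i : i \notin F' -> clock (new i) = (size s).+1.
  by move=> iF; rewrite new_decide //= clock_old.
have dvS : (size s).+1 %/ m.+1 = (j == m) + size s %/ m.+1.
  by rewrite divnS // dvdn_succ.
have mdS : (size s).+1 %% m.+1 = if j == m then 0 else j.+1.
  by rewrite modnS dvdn_succ.
have ltn_q : size s %/ m.+1 < n by rewrite ltn_divLR.
have old_current i b : i \notin F' ->
    current m (old i) b = (b == size s %/ m.+1 :> nat).
  by move=> iF; rewrite /current clock_old.
have new_current i b : i \notin F' -> j != m ->
    current m (new i) b -> current m (old i) b.
  by move=> iF /negbTE jm; rewrite old_current // /current new_clock // dvS jm.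
pose b0 := Ordinal ltn_q.
have cb0 i : i \notin F' -> current m (old i) b0 by move/old_current->.
split.
- move=> i b x iF; rewrite known_new //; case: ifP => [cb|_]; last first.
    by apply: known_true => //; apply: hp.
  case Ev: value => [y|] /=; first by case=> <-; apply: value_true Ev.
  exact: verdict_true.
- move=> i b iF; rewrite size_rcons dvS => ltb.
  have [kb|kb] := boolP (isSome (known (old i) b)); first by rewrite known_keep.
  have := contra (known_past Hs (hp i iF)) kb; rewrite -leqNgt => leb.
  have [jm eb] : j = m /\ b = b0.
    case: eqP ltb => [jm|_] ltb; last by rewrite ltnNge leb in ltb.
    split=> //; apply: val_inj => /=; apply/eqP.
    by rewrite eqn_leq leb andbT -ltnS -add1n.
  by rewrite eb known_last_stage // cb0.
- by move=> i u b x iF uF; rewrite new_heard //; apply: heard_mid_true.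
- move=> i u b iF uF; rewrite !new_heard // !heard_mid //.
  have := heard_own Hs (hp i iF) (hp u uF) (b := b).
  case: (heard (old u) b u) => [x /(_ isT)->//|_] /=.
  rewrite /current !clock_old //.
  by case: ifP => // ? ; case: (heard (old i) b u).
- move=> i iF un; rewrite size_rcons dvS mdS.
  have [jm|jm] := eqVneq j m.
    have kb0 := known_last_stage iF (cb0 i iF) jm.
    have := exposure_new_known iF (cb0 i iF) kb0.
    by move: (_ %/ _) (exposure _) #|_| => q e L; lia.
  have kb0 : known (new i) b0.
    apply: contraNT un => kb0; apply/existsP; exists b0; rewrite kb0 andbT.
    by rewrite /current new_clock // dvS (negbTE jm).
  have := exposure_new_known iF (cb0 i iF) kb0.
  by move: (_ %/ _) (exposure _) #|_| => q e L; lia.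
- move=> i b iF cb kb; rewrite size_rcons dvS mdS.
  have [jm|jm] := eqVneq j m.
    have kb0 := known_last_stage iF (cb0 i iF) jm.
    have := exposure_new_known iF (cb0 i iF) kb0.
    (* Here [b0] is finished and [b] starts at stage 0; the inequality is strict thanks to 2^0 =
       1. *)
    rewrite expn0.
    by move: (_ %/ _) (exposure _) #|_| => q e L; lia.
  exact: exposure_new_unknown iF (new_current i b iF jm cb) kb.
- move=> i b iF cb kb; rewrite size_rcons mdS.
  have [jm //|jm _] := eqVneq j m.
  exact: conflict_new iF (new_current i b iF jm cb) kb.
Qed.

End Step.

(** * The state after T rounds *)

Notation T := (n * m.+1)%N.

Definition no_flips : flips := [ffun=> nseq_tuple _ true].

(** Cut off at T, because all nonfaulty peers have halted by then. *)
Definition unlucky_rounds s : nat :=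
  \sum_(t < minn (size s) T) unlucky (take t s) (nth no_flips s t).

Lemma unlucky_rounds_rcons s w :
  unlucky_rounds (rcons s w) =
    unlucky_rounds s + (size s < T) && unlucky s w.
Proof.
rewrite /unlucky_rounds size_rcons; case: ltnP => leT.
  rewrite (minn_idPl leT) big_ord_recr /=; congr (_ + _).
    apply: eq_bigr => t _; rewrite nth_rcons ltn_ord -cats1 takel_cat //.
    exact: ltnW.
  by rewrite nth_rcons ltnn eqxx -cats1 take_size_cat.
rewrite (minn_idPr (leqW leT)) addn0; apply: eq_bigr => t _.
have lt := leq_trans (ltn_ord t) leT.
by rewrite nth_rcons lt -cats1 takel_cat // ltnW.
Qed.

Lemma sound_lucky s : size s <= T -> unlucky_rounds s = 0 -> sound s.
Proof.
elim/last_ind: s => [|s w IHs]; first by move=> _ _; apply: sound_nil.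
rewrite size_rcons => lt; rewrite unlucky_rounds_rcons lt.
move/eqP; rewrite addn_eq0 eqb0 => /andP[/eqP u0 uw].
by apply: sound_rcons => //; apply: IHs => //; apply: ltnW.
Qed.

Lemma peer_stopped s i : i \notin faulty (exec s) -> T <= size s ->
  peer_at s i = peer_at (take T s) i.
Proof.
elim/last_ind: s => [//|s w IHs] iF; rewrite size_rcons leq_eqVlt.
case/predU1P => [->|lt]; first by rewrite -(size_rcons s w) take_size.
have iF' := honest_prev iF.
rewrite stopped_step; first by rewrite -cats1 takel_cat // IHs.
by rewrite /running iF /= clock_at // (minn_idPr _) // ltnn.
Qed.

Lemma unlucky_rounds_take s : T <= size s ->
  unlucky_rounds (take T s) = unlucky_rounds s.
Proof.
move=> leT; rewrite /unlucky_rounds size_takel // minnn (minn_idPr leT).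
by apply: eq_bigr => t _; rewrite nth_take // take_takel // ltnW.
Qed.

Lemma sound_final s : T <= size s -> unlucky_rounds s = 0 ->
  sound (take T s).
Proof.
move=> leT u0; apply: sound_lucky; first by rewrite size_takel.
by rewrite unlucky_rounds_take.
Qed.

Lemma honest_take s t i : i \notin faulty (exec s) ->
  i \notin faulty (exec (take t s)).
Proof. by apply: contraNN => /(subsetP (faulty_take s t)). Qed.

Lemma final_exposure s i : T <= size s -> unlucky_rounds s = 0 ->
  i \notin faulty (exec s) -> exposure (peer_at s i) <= n + 4 * k.
Proof.
move=> leT u0 iF; have iF' := honest_take T iF.
rewrite peer_stopped //; have Hs := sound_final leT u0.
have := exposure_decided Hs iF'; rewrite size_takel // mulnK // modnMl addn0.
move=> le; apply: leq_trans (le _) _.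
  (* After T rounds the clock points to index n, so no bit is current and the bound for decided
     peers applies. *)
  apply/existsPn => b.
  rewrite /current clock_at // size_takel // minnn mulnK //.
  by rewrite ltn_eqF.
by rewrite leq_add2l leq_mul2l -[leqRHS]card_ord max_card.
Qed.

Lemma final_known s i b : T <= size s -> unlucky_rounds s = 0 ->
  i \notin faulty (exec s) ->
  known (peer_at s i) b = Some (tnth (source A) b).
Proof.
move=> leT u0 iF; have iF' := honest_take T iF.
rewrite peer_stopped //; have Hs := sound_final leT u0.
have := known_past Hs iF'; rewrite size_takel // mulnK // => /(_ b (ltn_ord b)).
by case Ek: known => [x|] // _; rewrite (known_true Hs iF' Ek).
Qed.

(** * Probability of unlucky rounds *)

Lemma faulty_step s w :
  faulty (exec (rcons s w)) =
    faulty (exec s) :|: corrupt seed (history (exec s)).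
Proof. by rewrite run_rcons. Qed.

Local Open Scope ring_scope.

(** Markov's inequality for the weight [y], which is at least 1 on unlucky flips. Peers that know
    the bit draw as well, so the event depends only on the fresh coins and the corrupted set. *)
Lemma sum_unlucky (R : realType) (g : R) s :
  (forall w, g <= #|~: faulty (exec (rcons s w))|%:R) -> 2 ^+ m.+1 <= g ->
  \sum_w (unlucky s w)%:R <=
    #|{: flips}|%:R * expR (1 - g / 2 ^+ m.+1) :> R.
Proof.
move=> hg mg; set j := (size s %% m.+1)%N.
have jm : (j <= m)%N by rewrite -ltnS ltn_pmod.
(* The corruptions of a round precede its coins, so any flips give the same set. *)
pose B := ~: faulty (exec (rcons s no_flips)).
have p2 i : 0 < 2 ^+ i :> R by rewrite exprn_gt0 // ltr0n.
pose y w : R := 2 ^+ (2 ^ j) * (1 / 2) ^+ #|[set i in B | lucky j (w i)]|.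
apply: (@le_trans _ _ (\sum_w y w)).
  apply: ler_sum => w _; have [lt|_] := boolP (unlucky s w); last first.
    by rewrite mulr_ge0 // exprn_ge0 // divr_ge0.
  rewrite /y expr_div_n expr1n mul1r -exprB ?unitfE ?pnatr_eq0 //.
    by rewrite exprn_ege1 // ler1n.
  apply: ltnW; apply: leq_trans lt.
  rewrite ltnS; apply/subset_leq_card/subsetP => i.
  by rewrite !inE !faulty_step.
rewrite /y -mulr_sumr sum_flips_lucky // mulrCA ler_wpM2l ?ler0n //.
exact: (lower_tail_le mg (hg no_flips) jm).
Qed.

Lemma sum_unlucky_rounds (R : realType) (g : R) N :
  (forall s, (size s <= N)%N -> g <= #|~: faulty (exec s)|%:R) ->
  2 ^+ m.+1 <= g ->
  \sum_(t : N.-tuple flips) (unlucky_rounds t)%:R <=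
    #|{: flips}|%:R ^+ N * (T%:R * expR (1 - g / 2 ^+ m.+1)) :> R.
Proof.
move=> hg mg; set eps := expR _.
(* The unlucky rounds so far plus [eps] for each remaining round form a supermartingale. *)
pose F s : R := (unlucky_rounds s)%:R + (T - size s)%:R * eps.
have F0 : F [::] = T%:R * eps.
  by rewrite /F /unlucky_rounds min0n big_ord0 add0r subn0.
rewrite -F0; apply: (@le_trans _ _ (\sum_(t : N.-tuple flips) F t)); last first.
  apply: sum_supermartingale => s lt.
  under eq_bigr => w _ do rewrite /F size_rcons unlucky_rounds_rcons natrD.
  rewrite /F mulrDr !big_split /= !sumr_const -[X in X + _ + _]mulr_natl.
  rewrite -addrA lerD2l.
  have [ltT|leT] := ltnP (size s) T; last first.
    have -> : (T - (size s).+1 = 0)%N by apply/eqP; rewrite subn_eq0 ltnW.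
    rewrite big1 // !mul0r mul0rn addr0.
    by rewrite mulr_ge0 ?ler0n ?mulr_ge0 ?ler0n ?expR_ge0.
  rewrite /= -(subnSK ltT) -[_ *+ #|_|]mulr_natl.
  rewrite [in leRHS]mulrS !mulrDl mul1r mulrDr lerD2r.
  by apply: sum_unlucky => // w; apply: hg; rewrite size_rcons.
by apply: ler_sum => t _; rewrite /F lerDl mulr_ge0 ?ler0n ?expR_ge0.
Qed.

(** * Queries of a single peer *)

Definition query_count s i : nat :=
  \sum_(l <- history (exec s)) #|queries l i|.

(* The exponential supermartingale of the queries of peer i, whose conditional
   expected number is [exposure / 2 ^ m]. *)
Definition query_potential (R : realType) s i : R :=
  2 ^+ query_count s i * expR (- ((exposure (peer_at s i))%:R / 2 ^+ m)).

(** If p is the query probability, the factor 2 per query has mean 1 + p, while the exposure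
    contributes exp(-p); 1 + p <= exp(p). *)
Lemma query_potential_rcons (R : realType) s i :
  \sum_w query_potential R (rcons s w) i <=
    #|{: flips}|%:R * query_potential R s i.
Proof.
set z := query_potential R s i.
have z0 : 0 <= z by rewrite mulr_ge0 ?exprn_ge0 ?expR_ge0.
set j := stage m (peer_at s i); set p : R := 2 ^+ j / 2 ^+ m.
(* Whether the peer queries if lucky is settled before the coins of the round. *)
pose e := [&& i \notin faulty (exec (rcons s no_flips)),
  clock (peer_at s i) < n * m.+1 & undecided m (peer_at s i)]%N.
have eE w : running s w i && undecided m (peer_at s i) = e.
  by rewrite /running /e !faulty_step andbA.
have stepE w : query_potential R (rcons s w) i =
    z * (2 ^+ (e && lucky j (w i)) * expR (- (e%:R * p))).
  rewrite /z /query_potential /query_count history_rcons -cats1 big_cat.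
  rewrite big_seq1 /= card_queries_last exposure_rcons !eE exprD natrD natrM.
  rewrite natrX mulrDl opprD expRD -/j -[_ * _ / _]mulrA -/p.
  by rewrite mulrACA.
under eq_bigr => w _ do rewrite stepE.
rewrite -mulr_sumr mulrC ler_wpM2r // -mulr_suml.
case: (e); last first.
  rewrite mul0r oppr0 expR0 mulr1 (eq_bigr (fun=> 1)) => [|w _].
    by rewrite sumr_const.
  by rewrite expr0.
have jm : (j <= m)%N by rewrite -ltnS ltn_pmod.
rewrite mul1r (eq_bigr (fun w : flips =>
    2 ^+ #|[set i' in [set i] | lucky j (w i')]|)) => [|w _]; last first.
  congr (_ ^+ _); rewrite -sum1_card (bigID (pred1 i)) /=.
  rewrite [X in (_ + X)%N]big1 => [|i'].
    2: by rewrite !inE => /andP[/andP[->]].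
  rewrite addn0; case lw: (lucky j (w i)).
    rewrite (big_pred1 i) // => i'.
    by rewrite !inE; case: eqP => // ->; rewrite lw.
  by rewrite big_pred0 // => i'; rewrite !inE; case: eqP => // ->; rewrite lw.
rewrite sum_flips_lucky // cards1 expr1.
rewrite -[2 - 1]/(1 + 1 - 1) addrK mul1r -/p.
rewrite -mulrA ler_piMr ?ler0n // expRN ler_pdivrMr ?expR_gt0 // mul1r.
exact: expR_ge1Dx.
Qed.

Lemma sum_query_potential (R : realType) N i :
  \sum_(t : N.-tuple flips) query_potential R t i <= #|{: flips}|%:R ^+ N.
Proof.
pose F s := query_potential R s i.
have hF s : (size s < N)%N -> \sum_w F (rcons s w) <= #|{: flips}|%:R * F s.
  by move=> _; apply: query_potential_rcons.
apply: le_trans (sum_supermartingale hF) _.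
rewrite /F /query_potential /query_count /= big_nil expr0 mul1r.
by rewrite mul0r oppr0 expR0 mulr1.
Qed.

End Execution.

(** * Complexity measures of an outcome *)

Section Outcome.
Variables (n k m H : nat).
Notation P := (download n k m).
Variables (A : adversary n k (coins P)) (w : outcome A H).
Notation T := (n * m.+1)%N.

Lemma finalE : final w = run w.2 w.1.
Proof. by rewrite /final /config_at take_oversize // size_tuple. Qed.

Lemma message_size_bound : message_size w <= 1.
Proof.
rewrite /message_size /nonfaulty finalE; apply: message_size_le1.
by rewrite disjoints_subset.
Qed.

Lemma message_complexity_bound : message_complexity w <= n * k ^ 2.
Proof.
rewrite /message_complexity /nonfaulty finalE; apply: message_total_le.
by rewrite disjoints_subset.
Qed.

Hypothesis TH : T <= H.

Lemma time_complexity_bound : time_complexity w <= T.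
Proof.
rewrite /time_complexity leqNgt; apply/negP => lt.
have := before_find 0 lt; rewrite nth_iota // add0n => /negP[].
apply/forall_inP => i; rewrite inE finalE => iF.
rewrite halted_clock /config_at clock_at; last exact: honest_take.
by rewrite size_takel ?size_tuple // minnn.
Qed.

Lemma all_correct_lucky : unlucky_rounds w.2 w.1 = 0 -> all_correct w.
Proof.
move=> u0; apply/forall_inP => i; rewrite inE finalE => iF; apply/eqP.
have leT : T <= size w.1 by rewrite size_tuple.
rewrite /= clock_at // leq_min leT leqnn; congr Some; apply: eq_from_tnth => b.
by rewrite tnth_mktuple final_known.
Qed.

End Outcome.

(** * Numerical estimates *)

Local Open Scope ring_scope.

Lemma expR_half_le (R : realType) : expR (1 / 2) <= 2 :> R.
Proof.
rewrite -[leLHS]invrK -expRN invf_ple ?posrE ?expR_gt0 //.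
by apply: le_trans (expR_ge1Dx _); lra.
Qed.

Lemma ln2_bounds (R : realType) : 1 / 2 <= ln (2 : R) <= 1.
Proof.
apply/andP; split; last by rewrite (le_trans (le_ln1Dx _)) //; lra.
by rewrite -ler_expR lnK ?posrE // expR_half_le.
Qed.

Lemma exists_dyadic (R : realType) (y : R) : 1 <= y ->
  exists m, 2 ^+ m <= y < 2 ^+ m.+1.
Proof.
move=> y1; have y0 : 0 <= y by rewrite (le_trans _ y1).
have /andP[le lt] := truncn_itv y0.
have t0 : (0 < Num.truncn y)%N by rewrite truncn_gt0.
have /andP[le2 lt2] := trunc_log_bounds (isT : 1 < 2)%N t0.
exists (trunc_log 2 (Num.truncn y)); rewrite -!natrX; apply/andP; split.
  by apply: le_trans le; rewrite ler_nat.
by apply: lt_le_trans lt _; rewrite ler_nat.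
Qed.

(** Markov's inequality: [F] dominates the indicator of failure. *)
Lemma uniform_prob_ge (R : realType) (I : finType) (E : pred I) (F : I -> R) q :
  (forall w, 0 <= F w) -> (forall w, ~~ E w -> 1 <= F w) ->
  (0 < #|I|)%N -> \sum_w F w <= #|I|%:R * q -> 1 - q <= uniform_prob R E.
Proof.
move=> F0 F1 I0 Fq; rewrite /uniform_prob ler_pdivlMr ?ltr0n //.
rewrite mulrBl mul1r lerBlDr -[X in X%:R <= _](cardC E) natrD lerD2l mulrC.
apply: le_trans Fq.
rewrite -sum1_card natr_sum big_mkcond ler_sum // => w _.
by case: ifP => [|_]; [apply: F1|apply: F0].
Qed.

Lemma powR_nat_expR (R : realType) n (x : R) : (0 < n)%N ->
  n%:R `^ x = expR (x * ln n%:R).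
Proof. by move=> n0; rewrite /powR gt_eqF // ltr0n. Qed.

(** Each summand gets half of n^(-c). Of c + 5, two units absorb T <= n^2 and three give exp(1 - 3
    ln n) <= 1/2; of c + 2, one absorbs k <= n and one gives 1/n <= 1/2. *)
Lemma failure_bound (R : realType) (c x : R) (n k T : nat) :
  (1 < n)%N -> (k <= n)%N -> (T <= n ^ 2)%N -> (c + 5) * ln n%:R <= x ->
  T%:R * expR (1 - x) + k%:R * n%:R `^ (- (c + 2)) <= n%:R `^ (- c).
Proof.
move=> n1 kn Tn xl; have n0 := ltnW n1; rewrite !powR_nat_expR //.
set l : R := ln n%:R; have nE : n%:R = expR l by rewrite lnK // posrE ltr0n.
have Tl : T%:R <= expR (2 * l) by rewrite expRM_natl -nE -natrX ler_nat.
have kl : k%:R <= expR l by rewrite -nE ler_nat.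
have el : expR (- l) <= 1 / 2.
  by rewrite expRN -nE mul1r lef_pV2 ?posrE ?ltr0n // ler_nat.
have e3 : expR (1 - 3 * l) <= 1 / 2.
  have -> : 1 - 3 * l = 1 / 2 + 1 / 2 + - l + - l + - l by lra.
  have eh := expR_half_le R.
  rewrite !expRD; have h0 := expR_gt0 (1 / 2 : R); have l0 := expR_gt0 (- l).
  move: (expR (1 / 2)) (expR (- l)) eh el h0 l0 => h y eh el h0 l0.
  have hy1 : h * y <= 1 by nra.
  have hy0 : 0 <= h * y by rewrite mulr_ge0 ?ltW.
  have -> : h * h * y * y * y = (h * y) * (h * y) * y by ring.
  rewrite -[leRHS]mul1r ler_pM ?mulr_ge0 ?(ltW l0) ?(ltW h0) //.
  by rewrite -[leRHS]mul1r ler_pM.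
have -> : expR (- c * l) = expR (- c * l) * (1 / 2) + expR (- c * l) * (1 / 2).
  by field.
apply: lerD.
  apply: (@le_trans _ _ (expR (2 * l) * expR (1 - (c + 5) * l))).
    by rewrite ler_pM ?ler0n ?expR_ge0 // ler_expR lerD2l lerN2.
  rewrite -expRD.
  rewrite (_ : 2 * l + (1 - (c + 5) * l) = - c * l + (1 - 3 * l)); last by ring.
  by rewrite expRD ler_wpM2l // expR_ge0.
apply: (@le_trans _ _ (expR l * expR (- (c + 2) * l))).
  by rewrite ler_wpM2r // expR_ge0.
rewrite -expRD (_ : l + - (c + 2) * l = - c * l + - l); last by ring.
by rewrite expRD ler_wpM2l // expR_ge0.
Qed.

(** Take logarithms and divide by ln 2; the factor 2 comes from ln 2 >= 1/2. *)
Lemma query_potential_lt (R : realType) (c : R) (n S : nat) (e : R) :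
  (1 < n)%N -> 0 <= e -> 0 <= c ->
  2 ^+ S * expR (- e) * n%:R `^ (- c) < 1 ->
  S%:R <= c * log2 n%:R + 2 * e.
Proof.
move=> n1 e0 c0; rewrite powR_nat_expR ?(ltnW n1) // /log2.
have l0 : 0 < ln n%:R :> R by rewrite ln_gt0 // ltr1n.
have /andP[h1 _] := ln2_bounds R.
rewrite -{1}(@lnK _ 2) ?posrE // -expRM_natl -!expRD.
rewrite -[X in _ < X -> _](@expR0 R) ltr_expR.
move: (ln n%:R) (ln 2) l0 h1 => l d l0 h1 lt.
have d0 : 0 < d by lra.
rewrite -(ler_pM2r d0) mulrDl -[c * (l / d) * d]mulrA divfK ?gt_eqF //; nra.
Qed.

(** * The total failure weight *)

Section Failure.
Variables (R : realType) (c g : R) (n k m H : nat).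
Notation P := (download n k m).
Variable A : adversary n k (coins P).
Notation T := (n * m.+1)%N.

(** A union bound in one quantity: the unlucky count is an integer, so a weight below 1 makes it 0
    and also bounds the potential of every peer. *)
Definition failure_weight (w : outcome A H) : R :=
  (unlucky_rounds w.2 w.1)%:R +
  \sum_i query_potential w.2 R w.1 i * n%:R `^ (- c).

Lemma query_potential_ge0 seed s i : 0 <= @query_potential n k m A seed R s i.
Proof. by rewrite mulr_ge0 ?exprn_ge0 ?expR_ge0. Qed.

Lemma failure_weight_ge0 w : 0 <= failure_weight w.
Proof.
rewrite addr_ge0 ?ler0n // sumr_ge0 // => i _.
by rewrite mulr_ge0 ?powR_ge0 ?query_potential_ge0.
Qed.

Lemma failure_weight_lt1 w : failure_weight w < 1 ->
  unlucky_rounds w.2 w.1 = 0 /\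
  forall i, query_potential w.2 R w.1 i * n%:R `^ (- c) < 1.
Proof.
have z0 i : 0 <= query_potential w.2 R w.1 i * n%:R `^ (- c).
  by rewrite mulr_ge0 ?powR_ge0 ?query_potential_ge0.
rewrite /failure_weight => lt; split=> [|i].
  apply/eqP; rewrite -leqn0 -ltnS -(ltr_nat R); apply: le_lt_trans lt.
  by rewrite lerDl sumr_ge0.
apply: le_lt_trans lt; rewrite (bigD1 i) //= addrCA lerDl.
by rewrite addr_ge0 ?ler0n // sumr_ge0.
Qed.

Lemma sum_failure_weight :
  (forall w : outcome A H, g <= #|~: faulty (final w)|%:R) -> 2 ^+ m.+1 <= g ->
  \sum_w failure_weight w <= #|{: outcome A H}|%:R *
    (T%:R * expR (1 - g / 2 ^+ m.+1) + k%:R * n%:R `^ (- c)).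
Proof.
move=> hg mg.
rewrite -(pair_bigA _ (fun t seed => failure_weight (t, seed))) /=.
rewrite exchange_big /= card_prod card_tuple natrM mulrAC -mulr_natr.
rewrite -[X in _ <= _ * X]sumr_const mulr_sumr ler_sum // => seed _.
rewrite mulr1 mul1r natrX mulrDr /failure_weight big_split /=; apply: lerD.
  apply: sum_unlucky_rounds => // s sH.
  (* The corruption bound concerns executions of length H; padding a shorter tape can only enlarge
     the faulty set. *)
  have size_t : size (s ++ nseq (H - size s) (no_flips n k m)) == H.
    by rewrite size_cat size_nseq subnKC.
  apply: le_trans (hg (Tuple size_t, seed)) _; rewrite finalE ler_nat /=.
  have := faulty_take seed (s ++ nseq (H - size s) (no_flips n k m)) (size s).
  by rewrite take_size_cat // -setCS; apply: subset_leq_card.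
rewrite exchange_big /=; under eq_bigr => i _ do rewrite -mulr_suml.
rewrite -mulr_suml mulrA ler_wpM2r ?powR_ge0 //.
rewrite mulr_natr -[leRHS](congr1 _ (card_ord k)) -sumr_const ler_sum // => i _.
exact: sum_query_potential.
Qed.

End Failure.

(** * Choice of m and of the constants *)

Lemma pow2_gt0 (R : realType) i : 0 < 2 ^+ i :> R.
Proof. by rewrite exprn_gt0 // ltr0n. Qed.

Lemma pow2_le_honest (R : realType) (m : nat) (b g : R) :
  2 <= b -> 2 ^+ m * b <= g -> 2 ^+ m.+1 <= g.
Proof.
by move=> b2; apply: le_trans; rewrite exprSr ler_wpM2l ?(ltW (pow2_gt0 R m)).
Qed.

Lemma rounds_le_sqr (n k m : nat) :
  (2 ^ m.+1 <= k)%N -> (k <= n)%N -> (n * m.+1 <= n ^ 2)%N.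
Proof.
move=> mk kn; rewrite expnS expn1 leq_mul2l; apply/orP; right.
apply: leq_trans kn; apply: leq_trans mk.
by apply: leq_trans (leq_pexp2l _ (leqnSn m)) => //; apply: ltn_expl.
Qed.

Lemma rounds_le_log (R : realType) (n k m : nat) : (2 ^ m.+1 <= k)%N ->
  (n * m.+1)%:R <= n%:R * log2 k%:R :> R.
Proof.
move=> mk; rewrite natrM ler_wpM2l ?ler0n //.
have /andP[h _] := ln2_bounds R; have d0 : 0 < ln 2 :> R by lra.
rewrite /log2 ler_pdivlMr // mulr_natl -lnXn ?ltr0n //.
rewrite ler_ln ?posrE ?pow2_gt0 //; first by rewrite -natrX ler_nat.
by rewrite ltr0n (leq_trans _ mk) ?expn_gt0.
Qed.

(** As e <= 5 n and 1 / 2^m < 2 b l / g, the term 2 e / 2^m is at most 20 b n l / g; g <= n lets n l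
    / g absorb l. *)
Lemma queries_le (R : realType) (c b l g : R) (n k m S e : nat) :
  0 <= c -> 0 <= b -> 0 <= l -> 0 < g -> g <= k%:R -> (k <= n)%N ->
  g < 2 ^+ m.+1 * (b * l) -> (e <= n + 4 * k)%N ->
  S%:R <= c * l + 2 * (e%:R / 2 ^+ m) ->
  S%:R <= (c + 20 * b) * (n%:R * l / g).
Proof.
move=> c0 b0 l0 g0 gk kn gm en /le_trans; apply.
have e5 : e%:R <= 5 * n%:R :> R.
  by rewrite -natrM ler_nat (leq_trans en) // (mulSn 4 n) leq_add2l leq_mul2l.
have gn : g <= n%:R by rewrite (le_trans gk) // ler_nat.
have e1 : e%:R / 2 ^+ m <= 10 * b * (n%:R * l / g).
  rewrite ler_pdivrMr ?pow2_gt0 // !mulrA mulrAC ler_pdivlMr //.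
  move: gm; rewrite exprS; have : 0 <= n%:R :> R by [].
  move: (2 ^+ m) (n%:R) (e%:R) e5 => p N E e5 N0 lt.
  have : E * g <= 5 * N * g by rewrite ler_wpM2r // ltW.
  have : 5 * N * g <= 5 * N * (2 * p * (b * l)).
    by rewrite ler_wpM2l ?(ltW lt) //; lra.
  lra.
have ln : l <= n%:R * l / g by rewrite ler_pdivlMr // mulrC ler_wpM2r.
have : c * l <= c * (n%:R * l / g) by rewrite ler_wpM2l.
lra.
Qed.

Theorem theorem2p5 (R : realType) (c : R) (hc : 1 <= c) :
  exists delta C : R,
  forall (beta : R) (n k : nat), 0 <= beta < 1 -> (k <= n)%N ->
  let gamma := 1 - beta in
  2 `^ delta * log2 n%:R ^+ 2 < 2 * gamma * k%:R ->
  exists P : protocol n k,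
  forall (H : nat) (A : adversary n k (coins P)),
  C * (n%:R * log2 k%:R) <= H%:R ->
  corrupts_at_most A H (beta * k%:R) ->
  (forall w : outcome A H, (message_size w)%:R <= C) /\
  1 - n%:R `^ (- c) <=
    uniform_prob R (fun w : outcome A H =>
      [&& all_correct w,
          (query_complexity w)%:R <= C * (n%:R * log2 n%:R / (gamma * k%:R)),
          (time_complexity w)%:R <= C * (n%:R * log2 k%:R)
        & (message_complexity w)%:R <= C * (n%:R * k%:R ^+ 2)]).
Proof.
(* [a] is 2 (c + 5), so that 2^m a l <= g yields the hypothesis of [failure_bound]; [C] is the
   constant of [queries_le] for c + 2 and [a]. *)
pose a := 2 * c + 10; pose C := c + 2 + 20 * a.
have a0 : 0 < a by rewrite /a; lra.
have C2 : 2 <= C by rewrite /C /a; lra.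
(* This delta gives 2^delta = 2 a. *)
exists (1 + log2 a), C => beta n k /andP[b0 b1] kn gamma hk.
(* n = 0 contradicts the strict hypothesis. For n = 1 the allowed failure probability is 1, so only
   the message size matters and any [m] serves. *)
have [n_le1|n1] := leqP n 1.
  have n_eq1 : n = 1%N.
    case: n n_le1 kn hk => [|[|//]] // _; rewrite leqn0 => /eqP-> /=.
    by rewrite mulr0 ltNge mulr_ge0 ?powR_ge0 ?sqr_ge0.
  exists (download n k 0) => H A _ _; split=> [w|].
    apply: (@le_trans _ _ 1); last by lra.
    by rewrite (ler_nat R _ 1) message_size_bound.
  have -> : n%:R `^ (- c) = 1 :> R by rewrite n_eq1 powR1.
  by rewrite subrr divr_ge0 ?ler0n.
have /andP[ln2_ge ln2_le] := ln2_bounds R; have ln2_gt0 : 0 < ln 2 :> R by lra.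
set l : R := log2 n%:R in hk *.
have l1 : 1 <= l.
  rewrite /l /log2 ler_pdivlMr // mul1r.
  by rewrite ler_ln ?posrE ?ltr0n ?ler_nat // ltnW.
set g : R := gamma * k%:R.
have powE : 2 `^ (1 + log2 a) = 2 * a :> R.
  rewrite powRD ?pnatr_eq0 ?implybT // powRr1 //; congr (_ * _).
  by rewrite /powR pnatr_eq0 /= /log2 divfK ?gt_eqF // lnK.
have al0 : 0 < a * l by rewrite mulr_gt0 //; lra.
have ag : a * l <= g.
  have : a * l <= a * l ^+ 2 by rewrite ler_pM2l // expr2; nra.
  by move: hk; rewrite powE -(mulrA 2 gamma) -/g; lra.
have gk : g <= k%:R by rewrite /g /gamma ler_piMl ?ler0n //; lra.
(* 2^m is the largest power of two up to g / (a l), so the initial query probability is about a log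
   n / (gamma k). *)
have /exists_dyadic[m /andP[mg gm]] : 1 <= g / (a * l).
  by rewrite ler_pdivlMr ?mul1r.
rewrite ler_pdivlMr // in mg; rewrite ltr_pdivrMr // in gm.
exists (download n k m) => H A hH hA.
have a12 : 12 <= a by rewrite /a; lra.
have al2 : 2 <= a * l by nra.
have g2 := pow2_le_honest al2 mg.
have mk : (2 ^ m.+1 <= k)%N by rewrite -(ler_nat R) natrX (le_trans g2).
have TC : (n * m.+1)%:R <= C * (n%:R * log2 k%:R).
  have Tl := rounds_le_log R n mk; apply: le_trans (Tl) _.
  by rewrite ler_peMl ?(le_trans _ Tl) //; lra.
have TH : (n * m.+1 <= H)%N by rewrite -(ler_nat R) (le_trans TC).
split=> [w|].
  apply: (@le_trans _ _ 1); last by lra.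
  by rewrite (ler_nat R _ 1) message_size_bound.
have honest (w : outcome A H) : g <= #|~: faulty (final w)|%:R.
  have := hA w.
  have : #|faulty (final w)|%:R + #|~: faulty (final w)|%:R = k%:R :> R.
    by rewrite -natrD cardsC card_ord.
  by rewrite /g /gamma; lra.
have small : n%:R `^ (- c) >= (n * m.+1)%:R * expR (1 - g / 2 ^+ m.+1) +
    k%:R * n%:R `^ (- (c + 2)).
  apply: failure_bound => //; first exact: rounds_le_sqr mk kn.
  have lnl : ln n%:R <= l.
    rewrite /l /log2 ler_pdivlMr // ler_piMr // ln_ge0 // ler1n.
    exact: ltnW.
  rewrite ler_pdivlMr ?pow2_gt0 // exprSr; apply: le_trans mg.
  rewrite mulrC -mulrA ler_wpM2l ?(ltW (pow2_gt0 R m)) //.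
  by rewrite mulrA (_ : 2 * (c + 5) = a) ?ler_wpM2l ?(ltW a0) // /a; ring.
apply: (@uniform_prob_ge _ _ _ (@failure_weight R (c + 2) n k m H A)) => [w|w||].
- exact: failure_weight_ge0.
- apply: contraNT; rewrite -ltNge => /failure_weight_lt1[u0 zlt].
  rewrite all_correct_lucky //=; apply/and3P; split.
  + have g0 : 0 < g by apply: lt_le_trans (pow2_gt0 R _) g2.
    have B0 : 0 <= C * (n%:R * l / g).
      apply: mulr_ge0; first by lra.
      apply: divr_ge0 (ltW g0); apply: mulr_ge0 (le_trans ler01 l1).
      by rewrite ler0n.
    (* The integer part of the real bound allows a maximum of naturals to be bounded peer by
       peer. *)
    rewrite -truncn_ge_nat //; apply/bigmax_leqP => i; rewrite inE finalE => iF.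
    rewrite truncn_ge_nat //; have c2 : 0 <= c + 2 by lra.
    have leT : (n * m.+1 <= size w.1)%N by rewrite size_tuple.
    apply: queries_le (final_exposure leT u0 iF) _ => //; try lra.
    apply: query_potential_lt (zlt i) => //.
    by rewrite divr_ge0 ?ler0n ?(ltW (pow2_gt0 R m)).
  + by apply: le_trans _ TC; rewrite ler_nat time_complexity_bound.
  + rewrite -natrX -natrM (@le_trans _ _ (n * k ^ 2)%:R) //.
      by rewrite ler_nat message_complexity_bound.
    by rewrite ler_peMl ?ler0n //; lra.
- rewrite card_prod !card_tuple card_ffun card_tuple card_bool.
  by rewrite muln_gt0 !expn_gt0.
- apply: le_trans (sum_failure_weight (c + 2) honest g2) _.
  by rewrite ler_wpM2l ?ler0n.
Qed.
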